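(* For all integers $n\ge 1$ and $j,\ell\ge 0$, there exists a one-to-one correspondence between signed permutations in $B_n$ with $j$ crossings and $\ell$ minus signs, and type B permutation tableaux of length $n$ with $j$ superfluous $1$'s and $\ell$ $1$'s on the main diagonal.
   Context: A signed permutation of $\{1,\dots,n\}$ is a sequence of integers $\pi=(\pi(1),\dots,\pi(n))$ with $-n\le\pi(i)\le n$ and $\{|\pi(1)|,\dots,|\pi(n)|\}=\{1,\dots,n\}$; $B_n$ is the set of all of them. The number of minus signs of $\pi$ is the number of $i\in\{1,\dots,n\}$ with $\pi(i)<0$. A crossing of $\pi\in B_n$ is a pair $(i,j)$ with $i,j\in\{1,\dots,n\}$ such that - $i<j\le\pi(i)<\pi(j)$, or - $-i<j\le-\pi(i)<\pi(j)$, or - $i>j>\pi(i)>\pi(j)$. A shifted Young diagram is a finite order ideal (down-set) of $\{(i,j)\in\mathbb{N}\times\mathbb{N}: i\le j\}$ (with $i,j\geq 1$) ordered by $(i,j)\ge(i',j')$ iff $i\ge i'$ and $j\ge j'$. The cell $(i,j)$ is drawn in row $i$ (rows numbered from top to bottom) and column $j$ (columns numbered from left to right); its shape $\lambda=(\lambda_1,\dots,\lambda_k)$ (a strictly decreasing, possibly empty, sequence of positive integers) lists the row lengths, so row $i$ consists of the cells $(i,j)$ with $i\le j\le i+\lambda_i-1$. The main diagonal consists of the cells $(i,i)$. A type B permutation tableau of length $n$ is a filling with $0$'s and $1$'s of a shifted Young diagram of shape $\lambda=(\lambda_1,\dots,\lambda_k)$ with $\lambda_1\le n$, such that: (i) any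 $0$ on the main diagonal has only $0$'s above it in its column; (ii) no $0$ has both a $1$ above it (in the same column) and a $1$ to its left (in the same row); (iii) each row contains at least one $1$. The empty diagram is allowed, and $n$ is part of the data (rightmost columns of length $0$ are allowed so that there are $n$ columns in total). A $1$ in a type B permutation tableau is superfluous if it is not the leftmost $1$ of its row. *)

(* Defs.v *)
(* MathComp. *)
From HB Require Import structures.
From mathcomp Require Import all_boot all_order all_algebra.

Set Implicit Arguments.
Unset Strict Implicit.
Unset Printing Implicit Defensive.

Import Order.TTheory GRing.Theory Num.Theory.

Local Open Scope ring_scope.

(* Indices run over 'I_n = {0, .., n-1}; the index i stands for the position
   (or the row, or the column) i + 1, which matters when positions are compared
   with the values of a signed permutation. *)
Definition pos (n : nat) (i : 'I_n) : int := i.+1%:Z.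

(* The last two conjuncts say that the set of absolute values of the entries is
   {1, .., n}, by double inclusion. *)
Definition is_signed_perm (n : nat) (s : n.-tuple int) : bool :=
  [&& all (fun x : int => - n%:Z <= x <= n%:Z) s,
      all [in iota 1 n] (map absz s)
    & all [in map absz s] (iota 1 n)].

Record signed_perm (n : nat) := SignedPerm {
  sp_val :> n.-tuple int;
  sp_valP : is_signed_perm sp_val }.

HB.instance Definition _ n := [isSub for @sp_val n].
HB.instance Definition _ n := [Choice of signed_perm n by <:].

Definition is_crossing (n : nat) (p : signed_perm n) (i j : 'I_n) : bool :=
  [|| [&& pos i < pos j, pos j <= tnth p i & tnth p i < tnth p j],
      [&& - pos i < pos j, pos j <= - tnth p i & - tnth p i < tnth p j]
    | [&& pos i > pos j, pos j > tnth p i & tnth p i > tnth p j]].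

Definition crossings (n : nat) (p : signed_perm n) : nat :=
  #|[set c : 'I_n * 'I_n | is_crossing p c.1 c.2]|.

Definition minus_signs (n : nat) (p : signed_perm n) : nat :=
  #|[set i : 'I_n | tnth p i < 0]|.

Local Open Scope nat_scope.

(* A cell is a pair (row, column). *)
Definition cell_le (n : nat) (c d : 'I_n * 'I_n) : bool :=
  (c.1 <= d.1) && (c.2 <= d.2).

(* A shifted Young diagram of shape lambda contains no cell outside
   'I_n * 'I_n exactly when lambda_1 <= n: a cell (i, j) of the diagram has
   i <= j, and the first row then contains a cell in column j. *)
Definition shifted_diagram (n : nat) (D : {set 'I_n * 'I_n}) : bool :=
  [forall d in D, d.1 <= d.2] &&
  [forall d in D, forall c : 'I_n * 'I_n,
     (c.1 <= c.2) && cell_le c d ==> (c \in D)].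

(* A filling of a diagram in 'I_n * 'I_n: None outside the diagram, Some true
   on the cells filled with 1, Some false on the cells filled with 0. *)
Definition filling (n : nat) := {ffun 'I_n * 'I_n -> option bool}.

Section Tableaux.
Variables (n : nat) (T : filling n).

Definition diagram : {set 'I_n * 'I_n} := [set c | T c != None].

Definition is_one (i j : 'I_n) : bool := T (i, j) == Some true.
Definition is_zero (i j : 'I_n) : bool := T (i, j) == Some false.

Definition one_above (i j : 'I_n) : bool :=
  [exists i' : 'I_n, (i' < i) && is_one i' j].
Definition one_left (i j : 'I_n) : bool :=
  [exists j' : 'I_n, (j' < j) && is_one i j'].

Definition diag_zero_rule : bool :=
  [forall i : 'I_n, is_zero i i ==>
     [forall i' : 'I_n, (i' < i) ==> is_zero i' i]].

Definition no_one_above_and_left : bool :=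
  [forall i : 'I_n, forall j : 'I_n, is_zero i j ==>
     ~~ (one_above i j && one_left i j)].

(* The rows of the diagram are the i that contain at least one cell. *)
Definition rows_have_one : bool :=
  [forall i : 'I_n, [exists j : 'I_n, (i, j) \in diagram] ==>
     [exists j : 'I_n, is_one i j]].

Definition is_ptableauB : bool :=
  [&& shifted_diagram diagram, diag_zero_rule, no_one_above_and_left
    & rows_have_one].

Definition superfluous_ones : nat :=
  #|[set c : 'I_n * 'I_n | is_one c.1 c.2 && one_left c.1 c.2]|.

Definition diagonal_ones : nat := #|[set i : 'I_n | is_one i i]|.

End Tableaux.

(* Type B permutation tableaux of length n. *)
Record ptableauB (n : nat) := PTableauB {
  pt_val :> filling n;
  pt_valP : is_ptableauB pt_val }.

HB.instance Definition _ n := [isSub for @pt_val n].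
HB.instance Definition _ n := [Finite of ptableauB n by <:].

(* Main.v *)
Require Import Defs.
From mathcomp Require Import all_boot all_order all_algebra all_fingroup ring zify.

(** The two families are finite, so it is enough that the joint distributions
    of the two pairs of statistics agree, that is, that the generating functions
    agree for every [n]; [q] marks crossings or superfluous ones, and [t] marks
    minus signs or diagonal ones.

    Tableaux.  Call a column free if it has no zero on the diagonal and no zero
    with a one to its left: these are the columns above which a one may still be
    placed.  Let [z] mark free columns.  A tableau of length n+1 has either an
    empty last column, which can be deleted, or a first row of full length, which
    can be deleted together with the first column.  In the second case the first
    row may have ones only in the new column and above free columns, so the
    generating function of the possible rows depends only on the number of free
    columns.  This is [tabgf_rec]: the generating function G_n(z) satisfies
    G_(n+1) = T G_n, where

      T f (z) = z f(z) + t z f(1+qz) + z (f(1+qz) - f(z)) / (1+(q-1)z),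

    and the tableaux are counted by T^n 1 at z = 1.  Since z -> 1+qz sends the
    q-integer [m] to [m+1], and 1+(q-1)[m] = q^m, the operator acts on functions
    of m; this is [step].

    Signed permutations.  Draw i -> pi(i) as an arc and read the positions and
    the values from n down to 1.  When h positions and h values wait for a
    partner, a new value or position stays open or is joined to a waiting partner,
    and in the second case the crossings that appear are counted by the waiting
    partners on one side of the chosen one.  The arcs that remain open at
    the end are the negative entries.  In terms of sets, the state is the family of
    all signed permutations of m+h whose positions beyond m carry values at most m
    (where negative values are allowed), so that every step is the removal
    of one entry: [admsum_value], [admsum_pos].
    Their generating function C(m,h) satisfies ([admsum_rec], [admsum_neg])

      C(m+1,h) = C(m,h+1) + ([h]+[h+1]) C(m,h) + [h]^2 C(m,h-1),
      C(0,h) = t^h [h]!.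

    Comparison.  On the polynomials (z-[1])...(z-[k]) the operator T is
    tridiagonal, with coefficients that involve t ([step_qfall]).  An explicit
    triangular change of basis gives polynomials Q_h with Q_0 = 1 and
    Q_h(1) = t^h [h]! on which T has exactly the coefficients of the recurrence of
    C(m,h) ([step_qlag]).  So C(m,h) is T^m Q_h at z = 1, and C(n,0), which counts
    all signed permutations, is T^n 1 at z = 1. *)

Set Implicit Arguments.
Unset Strict Implicit.
Unset Printing Implicit Defensive.

Import Order.TTheory GRing.Theory Num.Theory.

(** * Sums over ordinals *)

Local Open Scope nat_scope.

Lemma exists_lift n (h : 'I_n.+1) (P : pred 'I_n.+1) :
  [exists i, P i] = P h || [exists i, P (lift h i)].
Proof.
apply/existsP/orP => [[i]|[Ph|/existsP[i Pi]]]; last 2 first.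
- by exists h.
- by exists (lift h i).
by case: (unliftP h i) => [k|] -> Pi; [right; apply/existsP; exists k | left].
Qed.

Lemma ltn_lift n (h : 'I_n.+1) (i j : 'I_n) : (lift h i < lift h j) = (i < j).
Proof. by rewrite /= /bump; lia. Qed.

Lemma sum_ord_lift n (i0 : 'I_n.+1) (f : 'I_n.+1 -> nat) :
  \sum_i f i = f i0 + \sum_i f (lift i0 i).
Proof. exact: bigD1_ord. Qed.

Lemma sum_ord_interval n a b : \sum_(j < n) (a <= j < b) = minn n b - a.
Proof. by elim: n => [|n IHn]; rewrite ?big_ord0 ?big_ord_recr /= ?IHn; lia. Qed.

Local Open Scope ring_scope.

(** * The q-integers *)

Definition qint (R : pzRingType) (q : R) (m : nat) : R := \sum_(i < m) q ^+ i.

Definition qfact (R : pzRingType) (q : R) (m : nat) : R :=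
  \prod_(i < m) qint q i.+1.

Lemma qint0 (R : pzRingType) (q : R) : qint q 0 = 0.
Proof. exact: big_ord0. Qed.

Lemma qintSr (R : pzRingType) (q : R) m : qint q m.+1 = qint q m + q ^+ m.
Proof. exact: big_ord_recr. Qed.

Lemma qint1 (R : pzRingType) (q : R) : qint q 1 = 1.
Proof. by rewrite qintSr qint0 add0r. Qed.

Lemma qintSl (R : pzRingType) (q : R) m : qint q m.+1 = 1 + q * qint q m.
Proof.
rewrite /qint big_ord_recl mulr_sumr; congr (_ + _).
by apply: eq_bigr => i _; rewrite -exprS.
Qed.

Lemma expr_qint (R : comPzRingType) (q : R) m : q ^+ m = 1 + (q - 1) * qint q m.
Proof.
have := qintSl q m; rewrite qintSr => /(canRL (addKr _)) ->.
by ring.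
Qed.

Lemma qintB (R : comPzRingType) (q : R) k h : (k <= h)%N ->
  q ^+ k * qint q (h - k) = qint q h - qint q k.
Proof.
move=> le_kh; rewrite -{2}(subnKC le_kh).
elim: (h - k)%N => [|d IHd]; first by rewrite addn0 qint0 mulr0 subrr.
by rewrite addnS !qintSr mulrDr IHd exprD; ring.
Qed.

Lemma qfactS (R : pzRingType) (q : R) m : qfact q m.+1 = qfact q m * qint q m.+1.
Proof. exact: big_ord_recr. Qed.

(** * An operator that is tridiagonal in two ways *)

Section Operator.
Variables (F : fieldType) (q t : F).
Hypothesis q_neq0 : q != 0.
Hypothesis qint_neq0 : forall m, qint q m.+1 != 0.

Let br := qint q.

(** The operator T of the tableaux, read at the point z = [m]: there
    1+qz = [m+1] and the denominator 1+(q-1)z is q^m. *)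
Definition step (f : nat -> F) (m : nat) : F :=
  br m * (f m + t * f m.+1) + br m * q ^- m * (f m.+1 - f m).

Lemma iter_step_ext m f g : f =1 g -> iter m step f =1 iter m step g.
Proof.
by move=> eq_fg; elim: m => //= m IHm x; rewrite /step !IHm.
Qed.

Lemma iter_stepD m f g x :
  iter m step (fun y => f y + g y) x = iter m step f x + iter m step g x.
Proof.
by elim: m x => //= m IHm x; rewrite /step !IHm; ring.
Qed.

Lemma iter_stepZ m c f x :
  iter m step (fun y => c * f y) x = c * iter m step f x.
Proof. by elim: m x => //= m IHm x; rewrite /step !IHm; ring. Qed.

(** The polynomial (z-[1])...(z-[k]) at z = [m].  For k > 0 it vanishes at z = 1,
    the only point at which the tableaux are finally counted. *)
Definition qfall (k m : nat) : F := \prod_(i < k) (br m - br i.+1).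

Lemma qfallS k m : qfall k.+1 m = qfall k m * (br m - br k.+1).
Proof. exact: big_ord_recr. Qed.

Lemma qfall_shift k m : qfall k.+1 m.+1 = q ^+ k.+1 * br m * qfall k m.
Proof.
elim: k => [|k IHk].
  by rewrite qfallS /qfall !big_ord0 /br qint1 qintSl; ring.
by rewrite qfallS IHk qfallS /br (qintSl _ m) (qintSl _ k.+1) (exprS q k.+1); ring.
Qed.

(** By [qfall_shift], z -> 1+qz sends the k-th polynomial to q^k z times the
    previous one; hence the divided difference in T lowers the degree by one,
    with the factor [k].  What remains is to expand multiplication by z. *)
Lemma step_qfall k m :
  step (qfall k) m = (1 + t * q ^+ k) *
    (qfall k.+1 m + (br k + br k.+1) * qfall k m + br k ^+ 2 * qfall k.-1 m).
Proof.
case: k => [|k] /=.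
  by rewrite /step qfallS /qfall !big_ord0 /br qint1 qint0; ring.
rewrite /step qfall_shift !qfallS.
have -> : br k.+2 = 1 + q * br k.+1 by exact: qintSl.
have qm_neq0 : q ^+ m != 0 by rewrite expf_neq0.
have -> : q ^+ k.+1 = 1 + (q - 1) * br k.+1 by exact: expr_qint.
have -> : (1 + (q - 1) * br k.+1) * br m * qfall k m
          - qfall k m * (br m - br k.+1)
        = q ^+ m * (br k.+1 * qfall k m).
  by rewrite [q ^+ m]expr_qint -/(br m); ring.
rewrite -(mulrA (br m) (q ^- m)) mulKf //.
by ring.
Qed.

(** The coefficients [h]!^2 t^(h-k) / ([k]!^2 [h-k]!) of a q-Laguerre type change
    of basis.  For q = 1 and up to t^(h-k), they count the ways to choose h-k of h
    waiting values and h-k of h waiting positions and to match them. *)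
Definition lag_coef (h k : nat) : F :=
  if (k <= h)%N then
    t ^+ (h - k) * qfact q h ^+ 2 / (qfact q k ^+ 2 * qfact q (h - k))
  else 0.

Lemma qfact_neq0 m : qfact q m != 0.
Proof. by apply/prodf_neq0 => i _; apply: qint_neq0. Qed.

Lemma lag_coef_gt h k : (h < k)%N -> lag_coef h k = 0.
Proof. by rewrite /lag_coef ltnNge => /negbTE->. Qed.

Lemma lag_coefSS h k : br k.+1 ^+ 2 * lag_coef h.+1 k.+1 = br h.+1 ^+ 2 * lag_coef h k.
Proof.
rewrite /lag_coef ltnS; case: leqP => [le_kh|_]; last by rewrite !mulr0.
rewrite subSS !qfactS /br.
have := qfact_neq0 k; have := qfact_neq0 (h - k); have := qint_neq0 k => *.
by field; apply/and3P.
Qed.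

(** Multiplying by q^k turns the factor [h-k] into [h]-[k], so that no truncated
    subtraction is left and the identity also holds for k > h, where both sides
    vanish. *)
Lemma lag_coefS h k :
  q ^+ k * t * br k.+1 ^+ 2 * lag_coef h k.+1 = (br h - br k) * lag_coef h k.
Proof.
rewrite /lag_coef; case: (ltngtP k h) => [lt_kh|_|->]; last 2 first.
- by rewrite !mulr0.
- by rewrite subrr mul0r mulr0.
rewrite -(qintB q (ltnW lt_kh)) subnS qfactS.
case: (h - k)%N (subn_gt0 k h) => [|d _]; first by rewrite lt_kh.
rewrite /= qfactS (exprS t d) /br.
have := qfact_neq0 k; have := qfact_neq0 d.
have := qint_neq0 k; have := qint_neq0 d => *.
by field; apply/and4P.
Qed.

Lemma lag_coef0 h : lag_coef h 0 = t ^+ h * qfact q h.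
Proof.
rewrite /lag_coef subn0 /qfact big_ord0 -/(qfact q h).
by have := qfact_neq0 h => *; field.
Qed.

(** The terms with index k+1 are eliminated by [lag_coefS]; the identity left is
    [h+1]^2 = [k]^2 + [h+1-k] (q^k ([k]+[k+1]) + q^(2k+1) [h-k]), multiplied
    by q^k so that [h-k] appears only as ([h]-[k]) / q^k. *)
Lemma lag_coef_rec h k :
  lag_coef h.+1 k = (if k is k'.+1 then lag_coef h k' else 0)
    + t * q ^+ k * (br k + br k.+1) * lag_coef h k
    + t ^+ 2 * q ^+ (k.*2).+1 * br k.+1 ^+ 2 * lag_coef h k.+1.
Proof.
have -> : t ^+ 2 * q ^+ k.*2.+1 * br k.+1 ^+ 2 * lag_coef h k.+1
        = t * q ^+ k.+1 * (q ^+ k * t * br k.+1 ^+ 2 * lag_coef h k.+1).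
  by rewrite -addnn -addSn exprD; ring.
rewrite lag_coefS; case: k => [|k].
  rewrite !lag_coef0 qfactS /br (qintSl _ h) qint0 qint1.
  by rewrite exprS expr0 expr1; ring.
have k_neq0 : br k.+1 ^+ 2 != 0 by rewrite expf_neq0 ?qint_neq0.
apply: (mulfI k_neq0); rewrite lag_coefSS.
have qk_neq0 : q ^+ k != 0 by rewrite expf_neq0.
apply: (mulfI qk_neq0).
have lag_coefE := lag_coefS h k.
have -> : q ^+ k * (br k.+1 ^+ 2 * (lag_coef h k
    + t * q ^+ k.+1 * (br k.+1 + br k.+2) * lag_coef h k.+1
    + t * q ^+ k.+2 * ((br h - br k.+1) * lag_coef h k.+1)))
  = q ^+ k * br k.+1 ^+ 2 * lag_coef h k +
    (q ^+ k * t * br k.+1 ^+ 2 * lag_coef h k.+1) *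
    (q ^+ k.+1 * (br k.+1 + br k.+2) + q ^+ k.+2 * (br h - br k.+1)).
  by ring.
rewrite lag_coefE /br (qintSr _ k.+1) !(qintSl _ h) !(qintSr _ k) !exprS.
rewrite (expr_qint q k); ring.
Qed.

Definition sign_prod (k : nat) : F := \prod_(i < k) (1 + t * q ^+ i).

Lemma sign_prodS k : sign_prod k.+1 = sign_prod k * (1 + t * q ^+ k).
Proof. exact: big_ord_recr. Qed.

(** The factor [sign_prod k] absorbs the t-dependent coefficients 1 + t q^k of
    [step_qfall]. *)
Definition qlag (h m : nat) : F := \sum_(k < h.+1) lag_coef h k * sign_prod k * qfall k m.

Lemma qlag_widen K h m : (h < K)%N ->
  qlag h m = \sum_(k < K) lag_coef h k * sign_prod k * qfall k m.
Proof.
move=> lt_hK; rewrite /qlag.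
rewrite (big_ord_widen K (fun k => lag_coef h k * sign_prod k * qfall k m) lt_hK).
rewrite big_mkcond /=.
apply: eq_bigr => k _; case: ltnP => // lt_hk.
by rewrite lag_coef_gt ?mul0r.
Qed.

Lemma qlag0 m : qlag 0 m = 1.
Proof.
by rewrite /qlag big_ord1 lag_coef0 /sign_prod /qfall /qfact !big_ord0 expr0 !mulr1.
Qed.

Lemma qlag_at1 h : qlag h 1 = t ^+ h * qfact q h.
Proof.
rewrite /qlag big_ord_recl big1 => [|k _].
  by rewrite lag_coef0 /sign_prod /qfall !big_ord0 !mulr1 addr0.
by rewrite /qfall big_ord_recl subrr mul0r mulr0.
Qed.

Lemma step_sum K (c : nat -> F) (f : nat -> nat -> F) m :
  step (fun x => \sum_(k < K) c k * f k x) m = \sum_(k < K) c k * step (f k) m.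
Proof.
elim: K => [|K IHK]; first by rewrite /step !big_ord0; ring.
by rewrite big_ord_recr -IHK /step !big_ord_recr /=; ring.
Qed.

(** Divided by [sign_prod k] and t^(h-k-1), the coefficients of the k-th basis
    polynomial on both sides are polynomials of degree 2 in t: the constant parts
    agree by [lag_coefSS], the linear ones by [lag_coefS] and the quadratic ones
    by [lag_coef_rec]. *)
Lemma step_qlag h m :
  step (qlag h) m =
  qlag h.+1 m + (br h + br h.+1) * qlag h m + br h ^+ 2 * qlag h.-1 m.
Proof.
(* The common number of terms of the three sums; the extra ones are 0. *)
pose K := h.+2.
have -> : step (qlag h) m =
    step (fun x => \sum_(k < K) lag_coef h k * sign_prod k * qfall k x) m.
  by rewrite /step !(@qlag_widen K).
rewrite (step_sum K (fun k => lag_coef h k * sign_prod k)).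
rewrite !(@qlag_widen K); try by rewrite /K //; case: (h) => //= ?; rewrite !ltnS leqW.
rewrite !mulr_sumr -!big_split /=.
(* Contributions to the k-th basis polynomial from its two neighbours. *)
pose up k := (if k is k'.+1 then lag_coef h k' * sign_prod k else 0) * qfall k m.
pose dn k := lag_coef h k.+1 * sign_prod k.+2 * br k.+1 ^+ 2 * qfall k m.
have upE : \sum_(k < K) lag_coef h k * sign_prod k.+1 * qfall k.+1 m = \sum_(k < K) up k.
  rewrite big_ord_recr /= [in RHS]big_ord_recl /= /up lag_coef_gt // !mul0r.
  by rewrite addr0 add0r.
have dnE : \sum_(k < K) lag_coef h k * sign_prod k.+1 * br k ^+ 2 * qfall k.-1 m
         = \sum_(k < K) dn k.
  rewrite big_ord_recl [in RHS]big_ord_recr /= /dn [lag_coef h h.+2]lag_coef_gt //.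
  by rewrite /br qint0 expr0n !mulr0 !mul0r addr0 add0r.
have -> : \sum_(k < K) lag_coef h k * sign_prod k * step (qfall k) m
        = \sum_(k < K) (up k + lag_coef h k * sign_prod k.+1 * (br k + br k.+1)
                        * qfall k m + dn k).
  rewrite !big_split /= -upE -dnE -!big_split /=; apply: eq_bigr => k _.
  by rewrite step_qfall sign_prodS; ring.
apply: eq_bigr => k _; rewrite /up /dn !sign_prodS lag_coef_rec.
have h0E : br h ^+ 2 * lag_coef h.-1 k = br k.+1 ^+ 2 * lag_coef h k.+1.
  case: (h) => [|h'] /=; last by rewrite lag_coefSS.
  by rewrite [lag_coef 0 k.+1]lag_coef_gt // /br qint0 expr0n !mul0r mulr0.
have -> : br h ^+ 2 * (lag_coef h.-1 k * sign_prod k * qfall k m)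
        = (br h ^+ 2 * lag_coef h.-1 k) * sign_prod k * qfall k m by ring.
rewrite h0E.
have midE := lag_coefS h k.
have -> : (br h + br h.+1) * (lag_coef h k * sign_prod k * qfall k m) =
  sign_prod k * qfall k m * ((br k + br k.+1) * lag_coef h k
    + (1 + q) * (q ^+ k * t * br k.+1 ^+ 2 * lag_coef h k.+1)).
  by rewrite midE /br !(qintSl _ h) !(qintSl _ k); ring.
have -> : q ^+ (k : nat).*2.+1 = q * q ^+ k * q ^+ k.
  by rewrite -addnn exprS exprD mulrA.
rewrite !exprS; clear.
by case: (k : nat) => [|k']; rewrite ?sign_prodS; ring.
Qed.

(** By induction on m, C(m,h) is T^m Q_h at z = 1: one step of the recurrence in h
    is one application of [step_qlag]. *)
Lemma recurrence_step (C : nat -> nat -> F) :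
    (forall h, C 0 h = t ^+ h * qfact q h) ->
    (forall m h, C m.+1 h =
       C m h.+1 + (br h + br h.+1) * C m h + br h ^+ 2 * C m h.-1) ->
  forall m, C m 0 = iter m step (fun=> 1) 1.
Proof.
move=> C0 CS m.
have CE : forall h, C m h = iter m step (qlag h) 1.
  elim: m => [|m IHm] h; first by rewrite C0 /= qlag_at1.
  rewrite CS !IHm iterSr (iter_step_ext _ (step_qlag h)).
  by rewrite !iter_stepD !iter_stepZ.
by rewrite CE; apply: iter_step_ext; apply: qlag0.
Qed.

End Operator.

(** * Signed permutations with bounded entries *)

Local Open Scope nat_scope.

(** The three kinds of crossings, split by signs, for positions i, j that carry
    values of absolute value a, b with signs ei, ej (true for negative).  All
    numbers count from 0; this shifts positions and values alike. *)
Definition crossing_rel (ei ej : bool) (i j a b : nat) : bool :=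
  [|| [&& ~~ ei, ~~ ej, i < j, j <= a & a < b],
      [&& ei, ~~ ej, j <= a & a < b],
      [&& ~~ ei, ~~ ej, j < i, a < j & b < a],
      [&& ~~ ei, ej, j < i & a < j]
    | [&& ei, ej, j < i & a < b]].

Definition bperm (n : nat) : finType := ('S_n * {ffun 'I_n -> bool})%type.

Definition bcrossing n (p : bperm n) (i j : 'I_n) : bool :=
  crossing_rel (p.2 i) (p.2 j) i j (p.1 i) (p.1 j).

Definition ncross n (p : bperm n) : nat := \sum_i \sum_j bcrossing p i j.

Definition nneg n (p : bperm n) : nat := \sum_i p.2 i.

(** Inserts an entry with sign b at position i0 with value v and relabels the
    other positions and values increasingly. *)
Definition binsert n (b : bool) (i0 v : 'I_n.+1) (p : bperm n) : bperm n.+1 :=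
  (lift_perm i0 v p.1, [ffun i => if unlift i0 i is Some k then p.2 k else b]).

Lemma insert_perm_id n b (i0 v : 'I_n.+1) p : (binsert b i0 v p).1 i0 = v.
Proof. exact: lift_perm_id. Qed.

Lemma insert_perm_lift n b (i0 v : 'I_n.+1) p i :
  (binsert b i0 v p).1 (lift i0 i) = lift v (p.1 i).
Proof. exact: lift_perm_lift. Qed.

Lemma insert_sign_id n b (i0 v : 'I_n.+1) p : (binsert b i0 v p).2 i0 = b.
Proof. by rewrite ffunE unlift_none. Qed.

Lemma insert_sign_lift n b (i0 v : 'I_n.+1) p i :
  (binsert b i0 v p).2 (lift i0 i) = p.2 i.
Proof. by rewrite ffunE liftK. Qed.

Definition insertE := (insert_perm_id, insert_perm_lift, insert_sign_id, insert_sign_lift).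

Lemma insert_inj n b (i0 v : 'I_n.+1) : injective (binsert b i0 v).
Proof.
move=> [s e] [s' e'] eq_p; congr (_, _).
  apply/permP => i; apply: (@lift_inj _ v).
  by rewrite -(insert_perm_lift b i0 v (s, e)) -(insert_perm_lift b i0 v (s', e')) eq_p.
apply/ffunP => i.
by rewrite -(insert_sign_lift b i0 v (s, e)) -(insert_sign_lift b i0 v (s', e')) eq_p.
Qed.

Lemma insert_surj n b (i0 v : 'I_n.+1) (p : bperm n.+1) :
  p.1 i0 = v -> p.2 i0 = b -> exists p', p = binsert b i0 v p'.
Proof.
case: p => s e /= s_i0 e_i0.
pose f k := odflt k (unlift v (s (lift i0 k))).
have fK k : lift v (f k) = s (lift i0 k).
  rewrite /f; case: unliftP => //= /esym; rewrite -s_i0 => /perm_inj/eqP.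
  by rewrite (negPf (neq_lift _ _)).
have f_inj : injective f.
  move=> k1 k2 eq_f; apply: (@lift_inj _ i0); apply: (@perm_inj _ s).
  by rewrite -!fK eq_f.
exists (perm f_inj, [ffun k => e (lift i0 k)]); congr (_, _).
  apply/permP => i; case: (unliftP i0 i) => [k|] ->.
    by rewrite lift_perm_lift permE fK.
  by rewrite lift_perm_id.
apply/ffunP => i; rewrite ffunE; case: unliftP => [k|] -> //.
by rewrite ffunE.
Qed.

Lemma sum_insert (R : nmodType) n b (i0 v : 'I_n.+1) (P : pred (bperm n.+1))
    (w : bperm n.+1 -> R) :
  (\sum_(p | [&& P p, p.1 i0 == v & p.2 i0 == b]) w p =
   \sum_(p | P (binsert b i0 v p)) w (binsert b i0 v p))%R.
Proof.
rewrite -(big_imset _ (h := binsert b i0 v) (A := [pred p | P (binsert b i0 v p)])) /=;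
  last by move=> ? ? _ _ /insert_inj.
apply: eq_bigl => p; apply/and3P/imsetP => [[Pp /eqP s_i0 /eqP e_i0]|[p' Pp' ->]].
  by have [p' def_p] := insert_surj s_i0 e_i0; exists p'; rewrite ?inE -?def_p.
by rewrite !insertE !eqxx.
Qed.

Lemma nneg_insert n b (i0 v : 'I_n.+1) p : nneg (binsert b i0 v p) = b + nneg p.
Proof.
rewrite /nneg (sum_ord_lift i0) insertE; congr (_ + _).
by apply: eq_bigr => i _; rewrite insertE.
Qed.

Lemma ncross_insert n b (i0 v : 'I_n.+1) p :
  ncross (binsert b i0 v p) =
    \sum_j crossing_rel b (p.2 j) i0 (bump i0 j) v (bump v (p.1 j)) +
    \sum_j crossing_rel (p.2 j) b (bump i0 j) i0 (bump v (p.1 j)) v +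
    \sum_i \sum_j crossing_rel (p.2 i) (p.2 j) (bump i0 i) (bump i0 j)
      (bump v (p.1 i)) (bump v (p.1 j)).
Proof.
rewrite /ncross (sum_ord_lift i0) (sum_ord_lift i0) /bcrossing !insertE.
have -> : crossing_rel b b i0 i0 v v = 0 :> nat.
  by rewrite /crossing_rel !ltnn; case: b.
rewrite add0n -addnA; congr (_ + _).
  by apply: eq_bigr => j _; rewrite !insertE.
rewrite -big_split; apply: eq_bigr => i _; rewrite (sum_ord_lift i0) !insertE.
by congr (_ + _); apply: eq_bigr => j _; rewrite !insertE.
Qed.

(** The positions at least a are those already read, the values at least b
    those already read.  A positive arc between two read ends would have been
    removed, so the remaining read positions carry unread values or negative
    ones. *)
Definition adm n (a b : nat) (p : bperm n) : bool :=
  [forall i : 'I_n, (a <= i) ==> p.2 i || (p.1 i < b)].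

Lemma admP n a b (p : bperm n) :
  reflect (forall i : 'I_n, a <= i -> p.2 i || (p.1 i < b)) (adm a b p).
Proof.
by apply: (iffP forallP) => adm_p i; [apply/implyP | apply/implyP/adm_p].
Qed.

(** Relabelling keeps the order of the positions and that of the values; it can
    only disturb the comparison of a position j with a value a such that
    k <= a < j < i0, and then i or j would violate the bound on its value. *)
Lemma crossing_rel_insert_value k i0 i j a b ei ej :
    k < i0 -> (k < i -> ei || (a < k)) -> (k < j -> ej || (b < k)) ->
  crossing_rel ei ej (bump i0 i) (bump i0 j) (bump k a) (bump k b) =
  crossing_rel ei ej i j a b.
Proof. by rewrite /crossing_rel /bump; case: ei; case: ej; lia. Qed.

Lemma crossing_rel_insert_pos k v i j a b ei ej :
    k <= v -> (k <= i -> ei || (a < k)) -> (k <= j -> ej || (b < k)) ->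
  crossing_rel ei ej (bump k i) (bump k j) (bump v a) (bump v b) =
  crossing_rel ei ej i j a b.
Proof. by rewrite /crossing_rel /bump; case: ei; case: ej; lia. Qed.

(** The new arc goes down from i0 to k; it is crossed exactly by the arcs that
    start at the waiting positions k+1, ..., i0-1, all of which end below k. *)
Lemma ncross_insert_value n k (i0 v : 'I_n.+1) p :
    v = k :> nat -> k < i0 -> adm k.+1 k p ->
  ncross (binsert false i0 v p) = (i0 - k.+1) + ncross p.
Proof.
move=> def_v lt_ki /admP adm_p; rewrite ncross_insert def_v.
have -> : \sum_j crossing_rel false (p.2 j) i0 (bump i0 j) k (bump k (p.1 j))
          = i0 - k.+1.
  rewrite -[RHS](_ : minn n i0 - k.+1 = _); last by have := ltn_ord i0; lia.
  rewrite -sum_ord_interval; apply: eq_bigr => j _; congr nat_of_bool.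
  move: (adm_p j); rewrite /crossing_rel /bump.
  by case: (p.2 j) => /=; lia.
rewrite [X in _ + X + _]big1 => [|j _].
  rewrite addn0; congr (_ + _); apply: eq_bigr => i _; apply: eq_bigr => j _.
  by rewrite crossing_rel_insert_value //; apply: adm_p.
move: (adm_p j); rewrite /crossing_rel /bump.
by case: (p.2 j) => /=; lia.
Qed.

(** The new arc goes up from k to v; it is crossed exactly by the arcs that end
    at the waiting values k, ..., v-1 (before insertion), all of which start at
    negative entries or at positions before k. *)
Lemma ncross_insert_pos n k (i0 v : 'I_n.+1) p :
    i0 = k :> nat -> k <= v -> adm k k p ->
  ncross (binsert false i0 v p) = (v - k) + ncross p.
Proof.
move=> def_i le_kv /admP adm_p; rewrite ncross_insert def_i.
rewrite big1 => [|j _]; last first.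
  move: (adm_p j); rewrite /crossing_rel /bump.
  by case: (p.2 j) => /=; lia.
have -> : \sum_j crossing_rel (p.2 j) false (bump k j) k (bump v (p.1 j)) v = v - k.
  rewrite -[RHS](_ : minn n v - k = _); last by have := ltn_ord v; lia.
  rewrite -sum_ord_interval [RHS](reindex_inj (@perm_inj _ p.1)) /=.
  apply: eq_bigr => j _; congr nat_of_bool.
  move: (adm_p j); rewrite /crossing_rel /bump.
  by case: (p.2 j) => /=; lia.
rewrite add0n; congr (_ + _); apply: eq_bigr => i _; apply: eq_bigr => j _.
by rewrite crossing_rel_insert_pos //; apply: adm_p.
Qed.

(** If all entries are negative, crossings are inversions of absolute values. *)
Lemma ncross_insert_neg n (v : 'I_n.+1) p : adm 0 0 p ->
  ncross (binsert true ord0 v p) = v + ncross p.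
Proof.
move=> /admP adm_p; have neg_p i : p.2 i by have := adm_p i; rewrite ltn0 orbF; exact.
rewrite ncross_insert big1 => [|j _]; last by rewrite neg_p.
have -> : \sum_j crossing_rel (p.2 j) true (bump ord0 j) (@ord0 n) (bump v (p.1 j)) v = v.
  transitivity (minn n v - 0); last by have := ltn_ord v; lia.
  rewrite -sum_ord_interval [RHS](reindex_inj (@perm_inj _ p.1)) /=.
  apply: eq_bigr => j _; congr nat_of_bool.
  by rewrite neg_p /crossing_rel /bump /=; lia.
rewrite add0n; congr (_ + _); apply: eq_bigr => i _; apply: eq_bigr => j _.
by rewrite /bcrossing !neg_p /crossing_rel /bump /=; congr nat_of_bool; lia.
Qed.

Lemma adm_insert_value n k (i0 v : 'I_n.+1) p :
  v = k :> nat -> k < i0 -> adm k.+1 k.+1 (binsert false i0 v p) = adm k.+1 k p.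
Proof.
move=> def_v lt_ki; apply/admP/admP => adm_p i.
  by move: (adm_p (lift i0 i)); rewrite !insertE /= def_v /bump; case: (p.2 i) => /=; lia.
case: (unliftP i0 i) => [j|] ->; rewrite !insertE /= ?def_v //.
by move: (adm_p j); rewrite /bump; case: (p.2 j) => /=; lia.
Qed.

Lemma adm_insert_pos n k (i0 v : 'I_n.+1) p :
  i0 = k :> nat -> k <= v -> adm k.+1 k (binsert false i0 v p) = adm k k p.
Proof.
move=> def_i le_kv; apply/admP/admP => adm_p i.
  by move: (adm_p (lift i0 i)); rewrite !insertE /= def_i /bump; case: (p.2 i) => /=; lia.
case: (unliftP i0 i) => [j|] ->; rewrite !insertE /= ?def_i ?ltnn //.
by move: (adm_p j); rewrite /bump; case: (p.2 j) => /=; lia.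
Qed.

Lemma adm_insert_neg n (v : 'I_n.+1) p : adm 0 0 (binsert true ord0 v p) = adm 0 0 p.
Proof.
apply/admP/admP => adm_p i _.
  by have := adm_p (lift ord0 i); rewrite insertE /= ltn0 orbF; apply.
case: (unliftP ord0 i) => [j|] ->; rewrite !insertE //.
by have := adm_p j; rewrite ltn0 !orbF; apply.
Qed.

Local Open Scope ring_scope.

Section Weights.
Variables (R : comPzRingType) (q t : R).

Definition bweight n (p : bperm n) : R := q ^+ ncross p * t ^+ nneg p.

Definition admsum (n a b : nat) : R := \sum_(p : bperm n | adm a b p) bweight p.

Lemma sum_expr_shift n k :
  \sum_(i < n | (k <= i)%N) q ^+ (i - k) = qint q (n - k).
Proof.
rewrite -(big_geq_mkord k n xpredT (fun i => q ^+ (i - k))) -{1}[k]add0n big_addn.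
by rewrite big_mkord; apply: eq_bigr => i _; rewrite addnK.
Qed.

(** Reading the value k: either it is not used by a positive entry at a position
    beyond k, or it is, and then that entry is removed. *)
Lemma admsum_value n k : (k <= n)%N ->
  admsum n.+1 k.+1 k.+1 = admsum n.+1 k.+1 k + qint q (n - k) * admsum n k.+1 k.
Proof.
move=> le_kn; pose v : 'I_n.+1 := Ordinal (le_kn : (k < n.+1)%N).
rewrite /admsum (bigID (adm k.+1 k)) /=; congr (_ + _).
  apply: eq_bigl => p; apply: andb_idl => /admP adm_p.
  by apply/admP => i /adm_p; case: (p.2 i) => //=; lia.
rewrite -[(n - k)%N]subSS -sum_expr_shift mulr_suml.
rewrite (partition_big (fun p : bperm n.+1 => (p.1^-1)%g v)
          (fun i0 : 'I_n.+1 => k < i0)%N) /=.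
  apply: eq_bigr => i0 lt_ki.
  under eq_bigl => p.
    have -> : (adm k.+1 k.+1 p && ~~ adm k.+1 k p) && ((p.1^-1)%g v == i0) =
         [&& adm k.+1 k.+1 p, p.1 i0 == v & p.2 i0 == false].
      rewrite -andbA; case adm_p: (adm _ k.+1 p) => //=.
      have -> : ((p.1^-1)%g v == i0) = (p.1 i0 == v).
        by apply/eqP/eqP => [<-|<-]; rewrite ?permKV ?permK.
      case: eqP => [def_v|_]; last by rewrite andbF.
      rewrite andbT; apply/idP/eqP => [|neg_i0].
        move=> /admP nadm; apply/negbTE/negP => neg_i0; apply: nadm => i lt_ki'.
        have := admP _ _ _ adm_p i lt_ki'; case e_i: (p.2 i) => //=.
        rewrite ltnS leq_eqVlt => /orP[/eqP s_i|//].
        by rewrite -(_ : i0 = i) ?neg_i0 in e_i; last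
           by apply: (@perm_inj _ p.1); rewrite def_v; apply: val_inj.
      by apply/admP => /(_ i0 lt_ki); rewrite neg_i0 def_v ltnn.
    over.
  rewrite sum_insert mulr_sumr; apply: eq_big => [p|p]; rewrite ?adm_insert_value //.
  by move=> adm_p; rewrite /bweight (@ncross_insert_value _ k) // nneg_insert exprD mulrA.
move=> p /andP[/admP adm_p]; apply: contraR; rewrite -leqNgt => le_ik.
apply/admP => i lt_ki; have := adm_p i lt_ki; case: (p.2 i) => //=.
rewrite ltnS leq_eqVlt => /orP[/eqP s_i|//].
have def_v : p.1 i = v by apply: val_inj.
by rewrite -def_v permK leqNgt lt_ki in le_ik.
Qed.

(** Reading the position k: either it carries a negative entry or a value less
    than k, or it carries a value at least k, and then that entry is removed. *)
Lemma admsum_pos n k : (k <= n)%N ->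
  admsum n.+1 k.+1 k = admsum n.+1 k k + qint q (n - k).+1 * admsum n k k.
Proof.
move=> le_kn; pose i0 : 'I_n.+1 := Ordinal (le_kn : (k < n.+1)%N).
rewrite /admsum (bigID (adm k k)) /=; congr (_ + _).
  apply: eq_bigl => p; apply: andb_idl => /admP adm_p.
  by apply/admP => i lt_ki; apply: adm_p; apply: ltnW.
rewrite -subSn // -sum_expr_shift.
rewrite mulr_suml.
have admN p : adm k.+1 k p && ~~ adm k k p =
    [&& adm k.+1 k p, ~~ p.2 i0 & (k <= p.1 i0)%N].
  case adm_p: (adm k.+1 k p) => //=; rewrite leqNgt -negb_or; congr (~~ _).
  apply/admP/idP => [/(_ i0 (leqnn k))//|adm_i0 i].
  rewrite leq_eqVlt => /orP[/eqP def_i|]; last exact: (admP _ _ _ adm_p).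
  by rewrite -(_ : i0 = i) //; apply: val_inj.
rewrite (eq_bigl _ _ admN).
rewrite (partition_big (fun p : bperm n.+1 => p.1 i0)
          (fun v : 'I_n.+1 => k <= v)%N) /=; last by move=> p /and3P[].
apply: eq_bigr => v le_kv.
under eq_bigl => p.
  have -> : [&& adm k.+1 k p, ~~ p.2 i0 & (k <= p.1 i0)%N] && (p.1 i0 == v) =
       [&& adm k.+1 k p, p.1 i0 == v & p.2 i0 == false].
    case: eqP => [->|]; rewrite ?le_kv ?andbF //= !andbT.
    by case: (p.2 i0).
  over.
rewrite sum_insert mulr_sumr; apply: eq_big => [p|p]; rewrite ?adm_insert_pos //.
by move=> adm_p; rewrite /bweight (@ncross_insert_pos _ k) // nneg_insert exprD mulrA.
Qed.

Lemma admsum_neg n : admsum n 0 0 = t ^+ n * qfact q n.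
Proof.
elim: n => [|n IHn].
  rewrite /qfact big_ord0 expr0 mul1r /admsum.
  have p0 : bperm 0 := (1%g, [ffun=> false]).
  rewrite (big_pred1 p0) => [|p].
    by rewrite /bweight /ncross /nneg !big_ord0 mulr1.
  have -> : p = p0.
    by case: p p0 => s e [s' e']; congr (_, _); [apply/permP|apply/ffunP] => -[].
  by rewrite /= eqxx; apply/admP => -[].
rewrite qfactS exprSr.
have -> : t ^+ n * t * (qfact q n * qint q n.+1)
  = qint q n.+1 * (t * (t ^+ n * qfact q n)) by ring.
rewrite -IHn /qint mulr_suml /admsum.
rewrite (partition_big (fun p : bperm n.+1 => p.1 ord0) xpredT) //=.
apply: eq_bigr => v _.
under eq_bigl => p.
  have -> : adm 0 0 p && (p.1 ord0 == v) =
       [&& adm 0 0 p, p.1 ord0 == v & p.2 ord0 == true].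
    case: admP => //= adm_p; have := adm_p ord0 isT.
    by rewrite ltn0 orbF => ->; rewrite andbT.
  over.
rewrite sum_insert mulr_sumr mulr_sumr; apply: eq_big => [p|p]; rewrite ?adm_insert_neg //.
by move=> adm_p; rewrite /bweight ncross_insert_neg // nneg_insert !exprD; ring.
Qed.

(** One step for the value and one for the position, each of which either leaves
    an end open or closes an arc. *)
Lemma admsum_rec m h :
  admsum (m.+1 + h) m.+1 m.+1 =
    admsum (m + h.+1) m m
    + (qint q h + qint q h.+1) * admsum (m + h) m m
    + qint q h ^+ 2 * admsum (m + h.-1) m m.
Proof.
rewrite addSn addnS admsum_value ?leq_addr // admsum_pos ?leq_addr // addKn.
case: h => [|h]; first by rewrite qint0; ring.
rewrite addnS admsum_pos ?leq_addr // addKn /=.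
by ring.
Qed.

Lemma admsum_full n : admsum n n n = \sum_(p : bperm n) bweight p.
Proof. by apply: eq_bigl => p; apply/admP => i; rewrite leqNgt ltn_ord. Qed.

End Weights.

(** * Type B permutation tableaux and their free columns *)

Local Open Scope nat_scope.

Section Reflect.
Variables (n : nat) (T : filling n).

Record ptableauB_spec : Prop := PTableauSpec {
  cell_upper : forall i j : 'I_n, T (i, j) != None -> i <= j;
  cell_down : forall i j i' j' : 'I_n, T (i', j') != None ->
    i <= j -> i <= i' -> j <= j' -> T (i, j) != None;
  diag_zero : forall i i' : 'I_n, is_zero T i i -> i' < i -> is_zero T i' i;
  zero_above_left : forall i j i' : 'I_n, is_zero T i j -> one_left T i j ->
    i' < i -> ~~ is_one T i' j;
  row_one : forall i j : 'I_n, T (i, j) != None -> exists j', is_one T i j' }.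

Lemma ptableauBP : reflect ptableauB_spec (is_ptableauB T).
Proof.
apply: (iffP and4P) => [[/andP[/forall_inP upT /forall_inP downT] /forallP diagT
    /forallP leT /forallP rowT]|[upT downT diagT leT rowT]]; split.
- by move=> i j Tij; apply: (upT (i, j)); rewrite inE.
- move=> i j i' j' Tij le_ij le_ii' le_jj'.
  have := downT (i', j'); rewrite inE => /(_ Tij)/forall_inP/(_ (i, j)).
  by rewrite /cell_le /= le_ij le_ii' le_jj' inE; apply.
- by move=> i i' zT lt_i'; have /implyP/(_ zT)/forallP/(_ i')/implyP := diagT i; apply.
- move=> i j i' zT lT lt_i'; apply/negP => oT.
  have /forallP/(_ j)/implyP/(_ zT) := leT i; rewrite lT andbT => /negP[].
  by apply/existsP; exists i'; rewrite lt_i'.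
- move=> i j Tij; have /implyP rowTi := rowT i.
  have /rowTi/existsP[j' oT] : [exists j, (i, j) \in diagram T].
    by apply/existsP; exists j; rewrite inE.
  by exists j'.
- apply/andP; split; apply/forall_inP => -[i' j']; rewrite inE => Tij.
    exact: (upT i' j').
  by apply/forall_inP => -[i j] /andP[le_ij /andP[]]; rewrite inE; apply: downT Tij le_ij.
- apply/forallP => i; apply/implyP => zT; apply/forallP => i'; apply/implyP.
  exact: diagT.
- apply/forallP => i; apply/forallP => j; apply/implyP => zT; apply/negP => /andP[].
  by case/existsP => i' /andP[lt_i' oT] lT; have := leT i j i' zT lT lt_i'; rewrite oT.
- apply/forallP => i; apply/implyP => /existsP[j]; rewrite inE => /rowT[j' oT].
  by apply/existsP; exists j'.
Qed.

(** The columns above which a row may have a one: a one above a diagonal zero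
    would break the first rule, a one above a zero that has a one to its left
    the second.  Empty columns are free. *)
Definition free_col (j : 'I_n) : bool :=
  ~~ [exists i, is_zero T i j && ((i == j) || one_left T i j)].

Definition nfree : nat := \sum_j free_col j.

Lemma free_colP j :
  reflect (forall i, is_zero T i j -> i != j /\ ~~ one_left T i j) (free_col j).
Proof.
rewrite /free_col negb_exists; apply: (iffP forallP) => [fT i zT|fT i].
  by have := fT i; rewrite zT /= negb_or => /andP[].
by apply/negP => /andP[/fT[/negPf-> /negPf->]].
Qed.

Lemma superfluous_onesE :
  superfluous_ones T = \sum_i \sum_j (is_one T i j && one_left T i j).
Proof.
rewrite /superfluous_ones -sum1dep_card big_mkcond /=.
by rewrite -(pair_bigA _ (fun i j => is_one T i j && one_left T i j : nat)).
Qed.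

Lemma diagonal_onesE : diagonal_ones T = \sum_i is_one T i i.
Proof. by rewrite /diagonal_ones -sum1dep_card big_mkcond. Qed.

End Reflect.

(** * Adding an empty last column *)

Section AddCol.
Variables (n : nat) (T : filling n).

Definition add_col : filling n.+1 :=
  [ffun c => if unlift ord_max c.1 is Some i then
     if unlift ord_max c.2 is Some j then T (i, j) else None else None].

Lemma add_col_lift i j : add_col (lift ord_max i, lift ord_max j) = T (i, j).
Proof. by rewrite ffunE /= !liftK. Qed.

Lemma add_col_row j : add_col (ord_max, j) = None.
Proof. by rewrite ffunE /= unlift_none. Qed.

Lemma add_col_col i : add_col (i, ord_max) = None.
Proof. by rewrite ffunE /= unlift_none; case: unliftP. Qed.

Lemma add_col_one i j :
  is_one add_col (lift ord_max i) (lift ord_max j) = is_one T i j.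
Proof. by rewrite /is_one add_col_lift. Qed.

Lemma add_col_zero i j :
  is_zero add_col (lift ord_max i) (lift ord_max j) = is_zero T i j.
Proof. by rewrite /is_zero add_col_lift. Qed.

Lemma add_col_left i j :
  one_left add_col (lift ord_max i) (lift ord_max j) = one_left T i j.
Proof.
rewrite /one_left (exists_lift ord_max) /is_one add_col_col andbF orFb.
by apply: eq_existsb => j'; rewrite add_col_lift ltn_lift.
Qed.

Lemma add_col_ptableauB : is_ptableauB add_col = is_ptableauB T.
Proof.
apply/ptableauBP/ptableauBP => -[upT downT diagT leT rowT]; split.
- by move=> i j; rewrite -add_col_lift => /upT; rewrite !lift_max.
- move=> i j i' j'; rewrite -!add_col_lift => Tij *.
  by apply: downT Tij _ _ _; rewrite !lift_max.
- move=> i i'; rewrite -!add_col_zero => zT lt_i'.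
  by apply: diagT; rewrite ?lift_max.
- move=> i j i'; rewrite -add_col_zero -add_col_left -add_col_one => zT lT lt_i'.
  by apply: leT zT lT _; rewrite !lift_max.
- move=> i j; rewrite -add_col_lift => /rowT[j'].
  case: (unliftP ord_max j') => [k|] ->; rewrite /is_one ?add_col_col //.
  by rewrite add_col_lift; exists k.
- move=> i j; case: (unliftP ord_max i) => [i1|] ->; last by rewrite add_col_row.
  case: (unliftP ord_max j) => [j1|] ->; last by rewrite add_col_col.
  by rewrite add_col_lift !lift_max; apply: upT.
- move=> i j i' j'.
  case: (unliftP ord_max i') => [i1|] ->; last by rewrite add_col_row.
  case: (unliftP ord_max j') => [j1|] ->; last by rewrite add_col_col.
  rewrite add_col_lift !lift_max => Tij.
  case: (unliftP ord_max i) => [i2|] ->; last first.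
    by move=> _; rewrite leqNgt /= ltn_ord.
  case: (unliftP ord_max j) => [j2|] ->; last first.
    by move=> _ _; rewrite leqNgt /= ltn_ord.
  by rewrite add_col_lift !lift_max; apply: downT.
- move=> i i'; case: (unliftP ord_max i) => [i1|] ->; last first.
    by rewrite /is_zero add_col_row.
  rewrite add_col_zero => zT; case: (unliftP ord_max i') => [i2|] ->; last first.
    by rewrite ltnNge lift_max ltnW //= ltn_ord.
  by rewrite !lift_max add_col_zero; apply: diagT.
- move=> i j i'; case: (unliftP ord_max i) => [i1|] ->; last first.
    by rewrite /is_zero add_col_row.
  case: (unliftP ord_max j) => [j1|] ->; last by rewrite /is_zero add_col_col.
  rewrite add_col_zero add_col_left => zT lT.
  case: (unliftP ord_max i') => [i2|] ->; last by rewrite /is_one add_col_row.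
  by rewrite !lift_max add_col_one; apply: leT.
- move=> i j; case: (unliftP ord_max i) => [i1|] ->; last by rewrite add_col_row.
  case: (unliftP ord_max j) => [j1|] ->; last by rewrite add_col_col.
  rewrite add_col_lift => /rowT[j' oT]; exists (lift ord_max j').
  by rewrite add_col_one.
Qed.

Lemma add_col_free j : free_col add_col (lift ord_max j) = free_col T j.
Proof.
rewrite /free_col (exists_lift ord_max) /is_zero add_col_row /=; congr (~~ _).
apply: eq_existsb => i; rewrite add_col_lift add_col_left.
by rewrite (inj_eq lift_inj).
Qed.

Lemma add_col_nfree : nfree add_col = (nfree T).+1.
Proof.
rewrite /nfree (sum_ord_lift ord_max) -[RHS]add1n; congr (_ + _).
  by apply/eqP; rewrite eqb1; apply/free_colP => i; rewrite /is_zero add_col_col.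
by apply: eq_bigr => j _; rewrite add_col_free.
Qed.

Lemma add_col_superfluous : superfluous_ones add_col = superfluous_ones T.
Proof.
rewrite !superfluous_onesE (sum_ord_lift ord_max) big1 ?add0n => [|j _]; last first.
  by rewrite /is_one add_col_row.
apply: eq_bigr => i _; rewrite (sum_ord_lift ord_max) {1}/is_one add_col_col /=.
by apply: eq_bigr => j _; rewrite add_col_one add_col_left.
Qed.

Lemma add_col_diagonal : diagonal_ones add_col = diagonal_ones T.
Proof.
rewrite !diagonal_onesE (sum_ord_lift ord_max) {1}/is_one add_col_row /=.
by apply: eq_bigr => j _; rewrite add_col_one.
Qed.

End AddCol.

Lemma add_col_inj n : injective (@add_col n).
Proof.
by move=> T T' eq_T; apply/ffunP => -[i j]; rewrite -(add_col_lift T) eq_T add_col_lift.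
Qed.

Lemma add_col_surj n (T : filling n.+1) :
  is_ptableauB T -> T (ord0, ord_max) = None -> exists T', T = add_col T'.
Proof.
move=> /ptableauBP[upT downT _ _ _] T0.
exists [ffun c => T (lift ord_max c.1, lift ord_max c.2)].
have Tcol i : T (i, ord_max) = None.
  apply/eqP/negPn/negP => Ti; have := downT ord0 ord_max _ _ Ti.
  by rewrite T0 => /(_ isT isT (leqnn _)).
have Trow j : T (ord_max, j) = None.
  apply/eqP/negPn/negP => Tj; have le_j := upT _ _ Tj.
  suff def_j : j = ord_max by rewrite def_j Tcol in Tj.
  by apply: val_inj => /=; apply/eqP; rewrite eqn_leq le_j -ltnS ltn_ord.
apply/ffunP => -[i j]; case: (unliftP ord_max i) => [i1|] ->; last first.
  by rewrite add_col_row.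
case: (unliftP ord_max j) => [j1|] ->; last by rewrite add_col_col.
by rewrite add_col_lift ffunE.
Qed.

(** * Adding a full first row *)

Section AddRow.
Variables (n : nat) (r : {ffun 'I_n.+1 -> bool}) (T : filling n).

Definition add_row : filling n.+1 :=
  [ffun c => if unlift ord0 c.1 is Some i then
     if unlift ord0 c.2 is Some j then T (i, j) else None else Some (r c.2)].

(** In the first row, a zero makes its column not free when a one precedes it. *)
Definition seen (j : 'I_n.+1) : bool := [exists j' : 'I_n.+1, (j' < j) && r j'].

Lemma add_row_lift i j : add_row (lift ord0 i, lift ord0 j) = T (i, j).
Proof. by rewrite ffunE /= !liftK. Qed.

Lemma add_row_top j : add_row (ord0, j) = Some (r j).
Proof. by rewrite ffunE /= unlift_none. Qed.

Lemma add_row_left i : add_row (lift ord0 i, ord0) = None.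
Proof. by rewrite ffunE /= liftK unlift_none. Qed.

Lemma add_row_one i j : is_one add_row (lift ord0 i) (lift ord0 j) = is_one T i j.
Proof. by rewrite /is_one add_row_lift. Qed.

Lemma add_row_zero i j : is_zero add_row (lift ord0 i) (lift ord0 j) = is_zero T i j.
Proof. by rewrite /is_zero add_row_lift. Qed.

Lemma add_row_one_top j : is_one add_row ord0 j = r j.
Proof. by rewrite /is_one add_row_top; case: (r j). Qed.

Lemma add_row_zero_top j : is_zero add_row ord0 j = ~~ r j.
Proof. by rewrite /is_zero add_row_top; case: (r j). Qed.

Lemma add_row_one_left_top j : one_left add_row ord0 j = seen j.
Proof. by apply: eq_existsb => j'; rewrite add_row_one_top. Qed.

Lemma add_row_one_left i j :
  one_left add_row (lift ord0 i) (lift ord0 j) = one_left T i j.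
Proof.
rewrite /one_left (exists_lift ord0) {1}/is_one add_row_left andbF orFb.
by apply: eq_existsb => j'; rewrite add_row_one ltn_lift.
Qed.

Lemma add_row_free0 : free_col add_row ord0 = r ord0.
Proof.
rewrite /free_col (exists_lift ord0) add_row_zero_top eqxx andbT negb_or negbK.
case: (r ord0) => //=; apply/existsP => -[i].
by rewrite /is_zero add_row_left.
Qed.

Lemma add_row_free j : free_col add_row (lift ord0 j) =
  free_col T j && (r (lift ord0 j) || ~~ seen (lift ord0 j)).
Proof.
rewrite /free_col (exists_lift ord0) add_row_zero_top add_row_one_left_top.
rewrite (negPf (neq_lift _ _)) /= negb_or negb_and negbK andbC; congr (~~ _ && _).
apply: eq_existsb => i; rewrite add_row_zero add_row_one_left.
by rewrite (inj_eq lift_inj).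
Qed.

Definition row_ok : bool :=
  [forall j, r (lift ord0 j) ==> free_col T j] && [exists j, r j].

(** Zeros of the new row have nothing above them, so the rules of a tableau only
    bear on what the new row puts above the zeros of the old rows, which is
    the definition of a free column. *)
Lemma add_row_ptableauB : is_ptableauB add_row = is_ptableauB T && row_ok.
Proof.
apply/ptableauBP/idP => [[upT downT diagT leT rowT]|].
  apply/andP; split.
    apply/ptableauBP; split.
    - by move=> i j; rewrite -add_row_lift => /upT.
    - move=> i j i' j'; rewrite -!add_row_lift => Tij *.
      exact: downT Tij _ _ _.
    - by move=> i i'; rewrite -!add_row_zero => zT lt_i'; apply: diagT.
    - move=> i j i'; rewrite -add_row_zero -add_row_one_left -add_row_one => zT lT lt_i'.
      exact: leT zT lT _.
    - move=> i j; rewrite -add_row_lift => /rowT[j'].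
      case: (unliftP ord0 j') => [k|] ->; rewrite /is_one ?add_row_left //.
      by rewrite add_row_lift; exists k.
  apply/andP; split.
    apply/forallP => j; apply/implyP => rj; apply/free_colP => i zT.
    rewrite -add_row_zero in zT; split.
      apply: contraL rj => /eqP def_i; rewrite -add_row_zero_top.
      by apply: diagT; rewrite // -{1}def_i.
    apply/negP; rewrite -add_row_one_left => /(leT _ _ ord0 zT)/(_ isT).
    by rewrite add_row_one_top rj.
  have [|j] := rowT ord0 ord0; first by rewrite add_row_top.
  by rewrite add_row_one_top => rj; apply/existsP; exists j.
case/and3P=> /ptableauBP[upT downT diagT leT rowT] /forallP okT /existsP[j0 rj0]; split.
- move=> i j; case: (unliftP ord0 i) => [i1|] -> //.
  case: (unliftP ord0 j) => [j1|] ->; last by rewrite add_row_left.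
  by rewrite add_row_lift; apply: upT.
- move=> i j i' j'; case: (unliftP ord0 i) => [i1|] ->; last by rewrite add_row_top.
  case: (unliftP ord0 j) => [j1|] -> //.
  case: (unliftP ord0 i') => [i2|] -> //.
  case: (unliftP ord0 j') => [j2|] -> //.
  rewrite !add_row_lift; exact: downT.
- move=> i i'; case: (unliftP ord0 i) => [i1|] -> //.
  rewrite add_row_zero => zT; case: (unliftP ord0 i') => [i2|] -> lt_i'.
    by rewrite add_row_zero; apply: diagT.
  rewrite add_row_zero_top; apply/negP => ri.
  by have /implyP/(_ ri)/free_colP/(_ _ zT)[] := okT i1; rewrite eqxx.
- move=> i j i'; case: (unliftP ord0 i) => [i1|] -> //.
  case: (unliftP ord0 j) => [j1|] ->; last by rewrite /is_zero add_row_left.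
  rewrite add_row_zero add_row_one_left => zT lT.
  case: (unliftP ord0 i') => [i2|] -> lt_i'.
    by rewrite add_row_one; apply: leT zT lT _.
  rewrite add_row_one_top; apply/negP => rj.
  by have /implyP/(_ rj)/free_colP/(_ _ zT)[] := okT j1; rewrite lT.
- move=> i j; case: (unliftP ord0 i) => [i1|] ->; last first.
    by exists j0; rewrite add_row_one_top.
  case: (unliftP ord0 j) => [j1|] ->; last by rewrite add_row_left.
  rewrite add_row_lift => /rowT[j' oT]; exists (lift ord0 j').
  by rewrite add_row_one.
Qed.

Lemma add_row_nfree : nfree add_row =
  r ord0 + \sum_j (free_col T j && (r (lift ord0 j) || ~~ seen (lift ord0 j))).
Proof.
rewrite /nfree big_ord_recl add_row_free0; congr (_ + _).
by apply: eq_bigr => j _; rewrite add_row_free.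
Qed.

Lemma add_row_superfluous :
  superfluous_ones add_row = \sum_j (r j && seen j) + superfluous_ones T.
Proof.
rewrite !superfluous_onesE big_ord_recl; congr (_ + _).
  by apply: eq_bigr => j _; rewrite add_row_one_top add_row_one_left_top.
apply: eq_bigr => i _; rewrite big_ord_recl {1}/is_one add_row_left /=.
by apply: eq_bigr => j _; rewrite add_row_one add_row_one_left.
Qed.

Lemma add_row_diagonal : diagonal_ones add_row = r ord0 + diagonal_ones T.
Proof.
rewrite !diagonal_onesE big_ord_recl add_row_one_top; congr (_ + _).
by apply: eq_bigr => j _; rewrite add_row_one.
Qed.

End AddRow.

Lemma add_row_inj n :
  injective (fun x : filling n * {ffun 'I_n.+1 -> bool} => add_row x.2 x.1).
Proof.
move=> [T r] [T' r'] /= eq_T; congr (_, _).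
  by apply/ffunP => -[i j]; rewrite -(add_row_lift r T) eq_T add_row_lift.
by apply/ffunP => j; rewrite -(add_row_one_top r T) eq_T add_row_one_top.
Qed.

(** A diagram that contains the last cell of the first row contains the whole
    first row, and below this row the first column has no cell. *)
Lemma add_row_surj n (T : filling n.+1) :
  is_ptableauB T -> T (ord0, ord_max) != None -> exists r T', T = add_row r T'.
Proof.
move=> /ptableauBP[upT downT _ _ _] T0.
exists [ffun j => is_one T ord0 j], [ffun c => T (lift ord0 c.1, lift ord0 c.2)].
apply/ffunP => -[i j]; case: (unliftP ord0 i) => [i1|] ->; last first.
  rewrite add_row_top ffunE /is_one.
  have := downT ord0 j _ _ T0 isT isT; rewrite -ltnS => /(_ (ltn_ord j)).
  by case: (T (ord0, j)) => [[]|].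
case: (unliftP ord0 j) => [j1|] ->; first by rewrite add_row_lift ffunE.
rewrite add_row_left; apply/eqP/negPn/negP => Ti.
by have := upT _ _ Ti.
Qed.

Local Open Scope ring_scope.

(** The position of the leftmost one; the default is used only for zero rows. *)
Definition lead n (r : {ffun 'I_n.+1 -> bool}) : 'I_n.+1 :=
  odflt ord0 [pick p | r p && ~~ seen r p].

Lemma seen_lead n (r : {ffun 'I_n.+1 -> bool}) p :
  r p -> ~~ seen r p -> forall j, seen r j = (p < j)%N.
Proof.
move=> rp /existsPn nseen j; apply/existsP/idP => [[i /andP[lt_ij ri]]|lt_pj].
  by apply: leq_ltn_trans lt_ij; rewrite leqNgt; have := nseen i; rewrite ri andbT.
by exists p; rewrite lt_pj.
Qed.

Lemma lead_eq n (r : {ffun 'I_n.+1 -> bool}) p :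
  [exists j, r j] && (lead r == p) = r p && ~~ seen r p.
Proof.
rewrite /lead; case: pickP => [p' /andP[rp' nseen']|no_lead] /=.
  have -> : [exists j, r j] by apply/existsP; exists p'.
  have seenE := seen_lead rp' nseen'.
  apply/eqP/andP => [<-//|[rp]]; rewrite seenE -leqNgt => le_pp'.
  apply: val_inj; apply/eqP; rewrite eqn_leq le_pp' andbT leqNgt.
  by apply: contra nseen' => lt_pp'; apply/existsP; exists p; rewrite lt_pp'.
rewrite no_lead; apply/negP => /andP[/existsP[j rj] _].
case: (@arg_minnP _ j r val rj) => i ri min_i.
have /negP[] := negbT (no_lead i); rewrite ri; apply/existsPn => i'.
by apply/negP => /andP[lt_i' /min_i]; rewrite leqNgt lt_i'.
Qed.

(** * The weight of all first rows *)

Section Weights.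
Variables (R : comNzRingType) (q t : R).

Section Row.
Variable z : R.

(** The weight that the new row contributes in [add_row]; the exponent of z is the
    new number of free columns, as in [add_row_nfree]. *)
Definition row_weight n (f : pred 'I_n) (r : {ffun 'I_n.+1 -> bool}) : R :=
  q ^+ (\sum_j (r j && seen r j))%N * t ^+ r ord0 *
  z ^+ (r ord0 + \sum_j (f j && (r (lift ord0 j) || ~~ seen r (lift ord0 j))))%N.

(** Contribution of column k when the leftmost one is in column l: to its left a
    free column keeps its zero and stays free; to its right a free column either
    takes a superfluous one and stays free, or takes a zero and is lost. *)
Definition lead_factor n (f : pred 'I_n) (l k : 'I_n) : R :=
  if (k < l)%N then z ^+ f k else
  if k == l then (if f k then z else 0) else (1 + q * z) ^+ f k.

(** If u columns are free the sum is that of z^p (1+qz)^(u-p) for 1 <= p <= u, a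
    geometric sum; the induction removes the first column. *)
Lemma sum_lead_factor n (f : pred 'I_n) :
  (1 + (q - 1) * z) * (\sum_l \prod_k lead_factor f l k) =
  z * ((1 + q * z) ^+ (\sum_k f k)%N - z ^+ (\sum_k f k)%N).
Proof.
elim: n f => [|n IHn] f; first by rewrite !big_ord0; ring.
rewrite big_ord_recl big_ord_recl !(big_ord_recl n (fun k => nat_of_bool (f k))).
have -> : \prod_(i < n) lead_factor f ord0 (lift ord0 i) =
          (1 + q * z) ^+ (\sum_i f (lift ord0 i))%N.
  by rewrite expr_sum; apply: eq_bigr => i _.
have -> : \sum_(i < n) \prod_k lead_factor f (lift ord0 i) k =
  z ^+ f ord0 * \sum_l \prod_k lead_factor (fun i => f (lift ord0 i)) l k.
  rewrite mulr_sumr; apply: eq_bigr => l _; rewrite big_ord_recl; congr (_ * _).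
rewrite {1}/lead_factor /= mulrDr [X in _ + X = _]mulrCA IHn.
by case: (f ord0); rewrite /= ?add1n ?add0n ?exprS ?expr0; ring.
Qed.

(** Once the position p of the leftmost one is fixed, the weight of a row is a
    product over its cells, and it is 0 when a cell breaks a constraint.  The cell
    in column 0 is the new diagonal cell: a zero there makes column 0 not free. *)
Definition cell_factor n (f : pred 'I_n) (p j : 'I_n.+1) (b : bool) : R :=
  if unlift ord0 j is Some k then
    if (j < p)%N then (if b then 0 else z ^+ f k)
    else if j == p then (if b && f k then z else 0)
    else (if b then (if f k then q * z else 0) else 1)
  else if j == p then (if b then t * z else 0) else (if b then 0 else 1).

Lemma cell_factor0 n (f : pred 'I_n) p b : cell_factor f p ord0 b =
  if ord0 == p then (if b then t * z else 0) else (if b then 0 else 1).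
Proof. by rewrite /cell_factor unlift_none. Qed.

Lemma cell_factor_lift n (f : pred 'I_n) p k b :
  cell_factor f p (lift ord0 k) b =
    if (lift ord0 k < p)%N then (if b then 0 else z ^+ f k)
    else if lift ord0 k == p then (if b && f k then z else 0)
    else (if b then (if f k then q * z else 0) else 1).
Proof. by rewrite /cell_factor liftK. Qed.

Lemma prod_cell_factor n (f : pred 'I_n) p (r : {ffun 'I_n.+1 -> bool}) :
  \prod_j cell_factor f p j (r j) =
  if [forall j, r (lift ord0 j) ==> f j] && (r p && ~~ seen r p)
  then row_weight f r else 0.
Proof.
have prod0 j : cell_factor f p j (r j) = 0 -> \prod_j cell_factor f p j (r j) = 0.
  by move=> Fj; rewrite (bigD1 j) //= Fj mul0r.
case: ifP => [/and3P[/forallP okr rp nseen]|/negbT].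
  have seenE := seen_lead rp nseen.
  have r_lt (j : 'I_n.+1) : (j < p)%N -> r j = false.
    by move=> lt_jp; apply/negP => rj; case/existsP: nseen; exists j; rewrite lt_jp.
  pose a k := (r (lift ord0 k) && seen r (lift ord0 k) : nat).
  pose b k := (f k && (r (lift ord0 k) || ~~ seen r (lift ord0 k)) : nat).
  transitivity (t ^+ r ord0 * z ^+ r ord0 * \prod_k (q ^+ a k * z ^+ b k)); last first.
    rewrite big_split -!expr_sum /row_weight big_ord_recl seenE ltn0 andbF add0n exprD.
    by rewrite -/(a _) -/(b _) /=; ring.
  rewrite big_ord_recl; congr (_ * _).
    rewrite cell_factor0; case: eqP rp => [<- ->|/eqP p_neq0 _]; first by rewrite !expr1.
    by rewrite r_lt ?mulr1 // lt0n eq_sym.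
  apply: eq_bigr => k _; rewrite cell_factor_lift /a /b seenE; have := okr k.
  case: (ltngtP (lift ord0 k) p) => [/r_lt-> _|lt_pk|/val_inj eq_kp].
  - by rewrite /= andbT mul1r.
  - rewrite -(inj_eq val_inj) /= (gtn_eqF lt_pk) andbT orbF.
    by case: (r _) => /= [->|_]; rewrite ?andbF ?mulr1.
  by rewrite eq_kp eqxx rp /= => ->; rewrite mul1r.
rewrite !negb_and negbK => /or3P[/forallPn[k]|rp|/existsP[j /andP[lt_jp rj]]].
- rewrite negb_imply => /andP[rk /negPf fk]; apply: (prod0 (lift ord0 k)).
  by rewrite cell_factor_lift rk fk /=; do 2?case: ifP.
- apply: (prod0 p); rewrite (negPf rp); case: (unliftP ord0 p) => [k|] ->.
    by rewrite cell_factor_lift ltnn eqxx.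
  by rewrite cell_factor0 eqxx.
apply: (prod0 j); rewrite rj; case: (unliftP ord0 j) lt_jp => [k|] -> lt_jp.
  by rewrite cell_factor_lift lt_jp.
by rewrite cell_factor0 -(inj_eq val_inj) ltn_eqF.
Qed.

(** The first summand collects the rows whose diagonal cell is a one.  For a fixed
    leftmost one the sum over all rows of a product over the cells is a product of
    sums over single cells. *)
Lemma sum_row_weight n (f : pred 'I_n) :
  \sum_(r : {ffun 'I_n.+1 -> bool} |
      [forall j, r (lift ord0 j) ==> f j] && [exists j, r j]) row_weight f r =
  t * z * (1 + q * z) ^+ (\sum_j f j)%N + \sum_l \prod_k lead_factor f l k.
Proof.
rewrite (partition_big (@lead n) xpredT) //=.
have rowE p : \sum_(r : {ffun 'I_n.+1 -> bool} |
      [forall j, r (lift ord0 j) ==> f j] && [exists j, r j] && (lead r == p))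
      row_weight f r = \prod_j (cell_factor f p j true + cell_factor f p j false).
  under [RHS]eq_bigr => j _ do rewrite -(big_bool +%R (cell_factor f p j)).
  rewrite bigA_distr_bigA big_mkcond /=; apply: eq_bigr => r _.
  by rewrite prod_cell_factor -andbA lead_eq.
rewrite (eq_bigr _ (fun p _ => rowE p)) big_ord_recl; congr (_ + _).
  rewrite big_ord_recl !cell_factor0 eqxx addr0 expr_sum; congr (_ * _).
  apply: eq_bigr => k _; rewrite !cell_factor_lift.
  by case: (f k); rewrite /= ?expr1 ?add0r // addrC.
apply: eq_bigr => l _; rewrite big_ord_recl !cell_factor0 add0r mul1r.
apply: eq_bigr => k _; rewrite !cell_factor_lift ltn_lift (inj_eq lift_inj).
rewrite /lead_factor; case: ifP => _; first by rewrite add0r.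
case: ifP => _; first by rewrite addr0.
by case: (f k); rewrite /= ?expr1 ?add0r // addrC.
Qed.

End Row.

(** * Generating function of the tableaux *)

Definition tweight n (z : R) (T : filling n) : R :=
  q ^+ superfluous_ones T * t ^+ diagonal_ones T * z ^+ nfree T.

Definition tabgf n (z : R) : R := \sum_(T : filling n | is_ptableauB T) tweight z T.

(** A diagram without the last cell of the first row has no cell in the last
    column nor in the last row, so it fits in the smaller length. *)
Lemma sum_add_col n z :
  \sum_(T : filling n.+1 | is_ptableauB T && (T (ord0, ord_max) == None)) tweight z T
  = z * tabgf n z.
Proof.
rewrite /tabgf mulr_sumr.
transitivity (\sum_(T in [set add_col T' | T' : filling n in [pred T' | is_ptableauB T']])
    tweight z T).
  apply: eq_bigl => T; apply/andP/imsetP => [[okT /eqP T0]|[T' okT' ->]].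
    have [T' def_T] := add_col_surj okT T0; exists T' => //.
    by rewrite inE -add_col_ptableauB -def_T.
  by rewrite add_col_ptableauB add_col_col.
rewrite big_imset /=; last by move=> ? ? _ _ /add_col_inj.
apply: eq_bigr => T _.
rewrite /tweight add_col_superfluous add_col_diagonal add_col_nfree exprS.
by ring.
Qed.

Lemma sum_add_row n z :
  \sum_(T : filling n.+1 | is_ptableauB T && (T (ord0, ord_max) != None)) tweight z T
  = \sum_(T : filling n | is_ptableauB T) q ^+ superfluous_ones T * t ^+ diagonal_ones T
      * \sum_(r | row_ok r T) row_weight z (free_col T) r.
Proof.
under [RHS]eq_bigr => T _ do rewrite mulr_sumr.
rewrite pair_big_dep /=.
pose h (x : filling n * {ffun 'I_n.+1 -> bool}) := add_row x.2 x.1.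
transitivity (\sum_(T in [set h x | x in [pred x | is_ptableauB x.1 && row_ok x.2 x.1]])
    tweight z T).
  apply: eq_bigl => T; apply/andP/imsetP => [[okT T0]|[[T' r] okT' ->]].
    have [r [T' def_T]] := add_row_surj okT T0; exists (T', r) => //.
    by rewrite inE -add_row_ptableauB -def_T.
  by rewrite add_row_ptableauB add_row_top.
rewrite big_imset /=; last by move=> ? ? _ _ /add_row_inj.
apply: eq_bigr => -[T r] _.
rewrite /tweight /row_weight add_row_superfluous add_row_diagonal add_row_nfree.
by rewrite !exprD; ring.
Qed.

Lemma tabgf0 z : tabgf 0 z = 1.
Proof.
pose T0 : filling 0 := [ffun=> None].
rewrite /tabgf (big_pred1 T0) => [|T].
  by rewrite /tweight superfluous_onesE diagonal_onesE /nfree !big_ord0 !mulr1.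
have -> : T = T0 by apply/ffunP => -[[]].
by rewrite /= eqxx; apply/ptableauBP; split=> -[].
Qed.

(** The recurrence is multiplied by 1+(q-1)z, which need not be invertible in R.
    The two parts are the tableaux with an empty last column and those with a full
    first row. *)
Lemma tabgf_rec n z :
  (1 + (q - 1) * z) * tabgf n.+1 z =
  (1 + (q - 1) * z) * (z * (tabgf n z + t * tabgf n (1 + q * z)))
  + z * (tabgf n (1 + q * z) - tabgf n z).
Proof.
rewrite {1}/tabgf (bigID (fun T : filling n.+1 => T (ord0, ord_max) == None)) /=.
rewrite sum_add_col sum_add_row.
set S := (X in _ * (_ + X) = _).
have -> : (1 + (q - 1) * z) * (z * tabgf n z + S) =
    (1 + (q - 1) * z) * (z * tabgf n z) + (1 + (q - 1) * z) * S by ring.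
suff -> : (1 + (q - 1) * z) * S = (1 + (q - 1) * z) * (z * t * tabgf n (1 + q * z))
    + z * (tabgf n (1 + q * z) - tabgf n z) by ring.
rewrite /S /tabgf -sumrB !mulr_sumr -big_split; apply: eq_bigr => T _ /=.
rewrite (sum_row_weight z (free_col T)) /tweight.
have := sum_lead_factor z (free_col T); rewrite -/(nfree T).
move: (\sum_l _) => L; rewrite -/(nfree T) => LE.
have -> (a b c : R) : a * (b * (c + L)) = a * b * c + b * (a * L) by ring.
by rewrite LE; ring.
Qed.

End Weights.

(** * Both families have the same generating function *)

Section FieldIdentity.
Variables (F : fieldType) (q t : F).
Hypothesis q_neq0 : q != 0.
Hypothesis qint_neq0 : forall m, qint q m.+1 != 0.

Lemma tabgf_step n m : tabgf q t n (qint q m) = iter n (step q t) (fun=> 1) m.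
Proof.
elim: n m => [|n IHn] m /=; first exact: tabgf0.
have qm_neq0 : q ^+ m != 0 by rewrite expf_neq0.
apply: (mulfI qm_neq0); rewrite {1}expr_qint tabgf_rec -expr_qint -qintSl !IHn /step.
by field.
Qed.

Lemma sum_bweight_tabgf n : \sum_(p : bperm n) bweight q t p = tabgf q t n 1.
Proof.
rewrite -(qint1 q) tabgf_step -admsum_full -{1}[n]addn0.
apply: (@recurrence_step _ q t q_neq0 qint_neq0 (fun m h => admsum q t (m + h) m m)).
  by move=> h; apply: admsum_neg.
by move=> m h; apply: admsum_rec.
Qed.

End FieldIdentity.

Lemma rmorph_qint (R S : pzRingType) (f : {rmorphism R -> S}) (q : R) m :
  f (qint q m) = qint (f q) m.
Proof. by rewrite rmorph_sum; apply: eq_bigr => i _; rewrite rmorphXn. Qed.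

Lemma coef_sum_monomials (I : finType) (A : pred I) (a b : I -> nat) j l :
  (\sum_(x | A x) 'X^(a x) * 'X%:P ^+ b x : {poly {poly int}})`_j`_l =
  #|[pred x | A x && ((a x == j) && (b x == l))]|%:R.
Proof.
rewrite !coef_sum -sum1_card natr_sum big_mkcondr /=.
apply: eq_bigr => x _; rewrite -rmorphXn /= coefMC coefXn eq_sym.
by case: eqP => _; rewrite ?mul0r ?coef0 // mul1r coefXn eq_sym; case: eqP.
Qed.

(** [step] divides by q^m and [lag_coef] by q-factorials, so the identity is
    applied in the field of fractions of the polynomials in q over the polynomials
    in t; there the q-integers are not 0 because their constant term is 1. *)
Lemma equidistribution n j l :
  #|[pred p : bperm n | (ncross p == j) && (nneg p == l)]| =
  #|[pred T : filling n | is_ptableauB T &&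
      ((superfluous_ones T == j) && (diagonal_ones T == l))]|.
Proof.
pose P := {poly {poly int}}.
have q_neq0 : (tofrac ('X : P)) != 0 by rewrite tofrac_eq0 polyX_eq0.
have qint_neq0 m : qint (tofrac ('X : P)) m.+1 != 0.
  rewrite -rmorph_qint tofrac_eq0; apply/eqP => /(congr1 (fun p : P => p.[0])).
  by rewrite qintSl !hornerE => /eqP; rewrite oner_eq0.
have := @sum_bweight_tabgf _ _ (tofrac ('X%:P : P)) q_neq0 qint_neq0 n.
have -> : \sum_(p : bperm n) bweight (tofrac ('X : P)) (tofrac ('X%:P : P)) p =
    tofrac (\sum_(p : bperm n) 'X^(ncross p) * 'X%:P ^+ nneg p : P).
  by rewrite rmorph_sum; apply: eq_bigr => p _; rewrite rmorphM !rmorphXn.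
have -> : tabgf (tofrac ('X : P)) (tofrac ('X%:P : P)) n 1 =
    tofrac (\sum_(T : filling n | is_ptableauB T)
        'X^(superfluous_ones T) * 'X%:P ^+ diagonal_ones T : P).
  rewrite rmorph_sum; apply: eq_bigr => T _.
  by rewrite /tweight expr1n mulr1 rmorphM !rmorphXn.
move/eqP; rewrite tofrac_eq => /eqP/(congr1 (fun p : P => p`_j`_l)).
by rewrite !coef_sum_monomials => /eqP; rewrite eqr_nat => /eqP.
Qed.

(** * Signed permutations as pairs of a permutation and signs *)

Section SignedPerm.
Variable n : nat.

Definition signed_entry (p : bperm n) (i : 'I_n) : int :=
  if p.2 i then - (p.1 i).+1%:Z else (p.1 i).+1%:Z.

Lemma absz_signed_entry p i : absz (signed_entry p i) = (p.1 i).+1.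
Proof. by rewrite /signed_entry; case: (p.2 i); rewrite ?abszN. Qed.

Lemma signed_entries_is_signed_perm p :
  is_signed_perm [tuple signed_entry p i | i < n].
Proof.
apply/and3P; split.
- apply/allP => _ /tnthP[i ->]; rewrite tnth_mktuple /signed_entry.
  by have := ltn_ord (p.1 i); case: (p.2 i); lia.
- apply/allP => _ /mapP[_ /tnthP[i ->] ->].
  by rewrite tnth_mktuple absz_signed_entry /= mem_iota add1n !ltnS ltn_ord.
apply/allP => v; rewrite mem_iota add1n ltnS => /andP[v_gt0 le_vn] /=.
have lt_vn : (v.-1 < n)%N by rewrite prednK.
pose i := (p.1^-1)%g (Ordinal lt_vn).
apply/mapP; exists (tnth [tuple signed_entry p i | i < n] i).
  exact: mem_tnth.
by rewrite tnth_mktuple absz_signed_entry permKV /= prednK.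
Qed.

Definition to_signed_perm (p : bperm n) : signed_perm n :=
  SignedPerm (signed_entries_is_signed_perm p).

Lemma tnth_to_signed_perm p i : tnth (to_signed_perm p) i = signed_entry p i.
Proof. exact: tnth_mktuple. Qed.

Lemma to_signed_perm_inj : injective to_signed_perm.
Proof.
move=> [s e] [s' e'] eq_p.
have entryE i : signed_entry (s, e) i = signed_entry (s', e') i.
  by rewrite -!tnth_to_signed_perm eq_p.
congr (_, _).
  apply/permP => i; apply/val_inj/succn_inj.
  by rewrite -(absz_signed_entry (s, e)) entryE absz_signed_entry.
by apply/ffunP => i; have := entryE i; rewrite /signed_entry /=; do 2!case: ifP; lia.
Qed.

(** The n absolute values cover 1, ..., n, hence they are distinct. *)
Lemma to_signed_perm_surj (sp : signed_perm n) : exists p, to_signed_perm p = sp.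
Proof.
have /and3P[_ /allP abs_iota /allP iota_abs] := sp_valP sp.
have abs_in i : absz (tnth sp i) \in iota 1 n.
  by apply: abs_iota; apply: map_f; apply: mem_tnth.
have abs_gt0 i : (0 < absz (tnth sp i))%N by have := abs_in i; rewrite mem_iota => /andP[].
have lt_v i : ((absz (tnth sp i)).-1 < n)%N.
  by have := abs_in i; rewrite mem_iota prednK // add1n ltnS => /andP[].
pose v i := Ordinal (lt_v i).
have v_inj : injective v.
  move=> i i' /(congr1 val) /= /(congr1 succn); rewrite !prednK // => eq_abs.
  have /tuple_uniqP abs_inj : uniq (map_tuple absz sp).
    by apply: leq_size_uniq (iota_uniq 1 n) iota_abs _; rewrite size_map size_tuple size_iota.
  by apply: abs_inj; rewrite !tnth_map.
exists (perm v_inj, [ffun i => tnth sp i < 0]).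
apply/val_inj/eq_from_tnth => i; rewrite tnth_to_signed_perm /signed_entry /=.
by rewrite ffunE permE /= prednK //; case: ltrP; lia.
Qed.

Lemma to_signed_perm_bij : bijective to_signed_perm.
Proof.
pose p0 : bperm n := (1%g, [ffun=> false]).
pose g sp := odflt p0 [pick p | to_signed_perm p == sp].
have gK : cancel g to_signed_perm.
  move=> sp; rewrite /g; case: pickP => [p /eqP//|no_p].
  by have [p /eqP] := to_signed_perm_surj sp; rewrite no_p.
by exists g => // p; apply: to_signed_perm_inj; rewrite gK.
Qed.

Lemma is_crossing_to_signed_perm p i j :
  is_crossing (to_signed_perm p) i j = bcrossing p i j.
Proof.
rewrite /is_crossing !tnth_to_signed_perm /signed_entry /bcrossing /crossing_rel /pos.
by case: (p.2 i); case: (p.2 j); lia.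
Qed.

Lemma crossings_to_signed_perm p : crossings (to_signed_perm p) = ncross p.
Proof.
rewrite /crossings -sum1dep_card big_mkcond /ncross /=.
rewrite (pair_bigA _ (fun i j => bcrossing p i j : nat)) /=.
by apply: eq_bigr => c _; rewrite is_crossing_to_signed_perm.
Qed.

Lemma minus_signs_to_signed_perm p : minus_signs (to_signed_perm p) = nneg p.
Proof.
rewrite /minus_signs -sum1dep_card big_mkcond; apply: eq_bigr => i _.
by rewrite tnth_to_signed_perm /signed_entry; case: (p.2 i).
Qed.

End SignedPerm.

(** * From equal cardinalities to a bijection *)

Lemma card_ptableauB n (Q : pred (filling n)) :
  #|[pred T : ptableauB n | Q T]| = #|[pred T : filling n | is_ptableauB T && Q T]|.
Proof.
rewrite -(card_imset _ val_inj); apply: eq_card => T.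
apply/imsetP/andP => [[T' QT' ->]|[okT QT]]; first by split=> //; apply: (valP T').
by exists (PTableauB okT).
Qed.

Lemma bij_of_eq_card (A B : finType) : #|A| = #|B| -> exists f : A -> B, bijective f.
Proof.
move=> eqAB; exists (fun x => enum_val (cast_ord eqAB (enum_rank x))).
exists (fun y => enum_val (cast_ord (esym eqAB) (enum_rank y))) => x.
  by rewrite enum_valK cast_ordK enum_rankK.
by rewrite enum_valK cast_ordKV enum_rankK.
Qed.

Lemma bij_sig (A B : Type) (P : pred A) (Q : pred B) (f : A -> B) :
    bijective f -> (forall x, Q (f x) = P x) ->
  exists g : {x | P x} -> {y | Q y}, bijective g.
Proof.
move=> [f' fK f'K] QP; have PQ y : P (f' y) = Q y by rewrite -QP f'K.
exists (fun x => exist _ (f (val x)) (etrans (QP _) (valP x))).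
exists (fun y => exist _ (f' (val y)) (etrans (PQ _) (valP y))) => x.
  by apply: val_inj; rewrite /= fK.
by apply: val_inj; rewrite /= f'K.
Qed.

Theorem theorem4 (n j l : nat) (hn : (1 <= n)%N) :
  exists f : {p : signed_perm n | (crossings p == j) && (minus_signs p == l)} ->
             {T : ptableauB n | (superfluous_ones T == j) && (diagonal_ones T == l)},
    bijective f.
Proof.
have [g toK gK] := to_signed_perm_bij n.
have [|f1 f1_bij] := @bij_sig _ _
  (fun p : signed_perm n => (crossings p == j) && (minus_signs p == l))
  (fun p : bperm n => (ncross p == j) && (nneg p == l)) g (Bijective gK toK).
  by move=> p; rewrite -[in RHS](gK p) crossings_to_signed_perm minus_signs_to_signed_perm.
have [|f2 f2_bij] := @bij_of_eq_card
  {p : bperm n | (ncross p == j) && (nneg p == l)}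
  {T : ptableauB n | (superfluous_ones T == j) && (diagonal_ones T == l)}.
  rewrite !card_sig equidistribution; apply/esym.
  exact: (card_ptableauB (fun T => (superfluous_ones T == j) && (diagonal_ones T == l))).
by exists (f2 \o f1); apply: bij_comp.
Qed.
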